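(* Let $Q_1,\dots,Q_s\in\mathcal{R}$ be bihomogeneous invariants of positive degree with $V(Q_1,\dots,Q_s)=\mathcal{N}_{5,3}$. Then $s\ge 8$. In particular, every homogeneous system of parameters of $\mathcal{R}$ contains a member that is not bihomogeneous.
   Context: $k$ is an algebraically closed field of characteristic zero, $V_n$ is the space of binary forms of degree $n$ in $x,y$ over $k$, and $\mathrm{SL}_2(k)$ acts on pairs $(F,G)\in V_5\oplus V_3$ by simultaneous linear substitution of variables. $\mathcal{R}=k[V_5\oplus V_3]^{\mathrm{SL}_2}$ is bigraded by the degrees in the coefficients of $F$ and of $G$; ''bihomogeneous'' refers to this bigrading, ''homogeneous'' and ''degree'' to the total degree. The null cone $\mathcal{N}_{5,3}\subset V_5\oplus V_3$ is the common zero set of all homogeneous elements of $\mathcal{R}$ of positive degree, and $V(Q_1,\dots,Q_s)$ is the common zero set in $V_5\oplus V_3$. A homogeneous system of parameters consists of $\dim\mathcal{R}=7$ homogeneous elements of positive degree over which $\mathcal{R}$ is a finite module. *)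

(* Defs.v *)
From HB Require Import structures.
From mathcomp Require Import all_boot all_order all_algebra.
From mathcomp.multinomials Require Export mpoly.

Set Implicit Arguments.
Unset Strict Implicit.
Unset Printing Implicit Defensive.

Import GRing.Theory.
Local Open Scope ring_scope.

(* Binary forms of degree n; the variables x, y are 'X_0, 'X_1. *)
Definition binary_form (k : closedFieldType) (n : nat) := dhomog 2 k n.

(* x |-> g_00 x + g_01 y,  y |-> g_10 x + g_11 y *)
Definition linsubst (k : closedFieldType) (g : 'M[k]_2) :
    2.-tuple {mpoly k[2]} :=
  [tuple \sum_(j < 2) g i j *: 'X_j | i < 2].

Lemma linsubst_homog (k : closedFieldType) (n : nat) (g : 'M[k]_2)
    (F : binary_form k n) : (F : {mpoly k[2]}) \mPo linsubst g \is n.-homog.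
Proof.
rewrite comp_mpolyEX big_seq; apply: rpred_sum => m mF; apply: rpredZ.
have <- : mdeg m = n by apply: (dhomogP _ _ _ (dhomog_is_dhomog F)).
rewrite comp_mpolyX mdegE.
apply: (big_ind2 (fun (p : {mpoly k[2]}) d => p \is d.-homog)).
- exact: dhomog1.
- by move=> p d q e; apply: dhomogM.
move=> i _; rewrite tnth_mktuple -[X in X.-homog]mul1n; apply: dhomogMn.
by apply: rpred_sum => j _; apply: rpredZ; rewrite dhomogX /= mdeg1.
Qed.

Definition form_act (k : closedFieldType) (n : nat) (g : 'M[k]_2)
    (F : binary_form k n) : binary_form k n :=
  DHomog (linsubst_homog g F).

Definition V53 (k : closedFieldType) : Type :=
  (binary_form k 5 * binary_form k 3)%type.

Definition V53_act (k : closedFieldType) (g : 'M[k]_2) (v : V53 k) : V53 k :=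
  (form_act g v.1, form_act g v.2).

(* The coefficient of x^(n-j) y^j, without binomial normalization. *)
Definition form_coef (k : closedFieldType) (n : nat) (F : binary_form k n)
    (j : 'I_n.+1) : k :=
  (F : {mpoly k[2]})@_
    [multinom (if i == ord0 then (n - j)%N else j : nat) | i < 2].

(* k[V_5 (+) V_3] is {mpoly k[6 + 4]}: variables 0..5 are the coefficients
   of the quintic F, variables 6..9 those of the cubic G. *)
Definition coords (k : closedFieldType) (v : V53 k) (i : 'I_(6 + 4)) : k :=
  match split i with
  | inl j => form_coef v.1 j
  | inr j => form_coef v.2 j
  end.

Definition value (k : closedFieldType) (P : {mpoly k[6 + 4]}) (v : V53 k) : k :=
  P.@[coords v].

(* Membership in k[V_5 (+) V_3]^{SL_2}; as k is infinite, a polynomial is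
   determined by the function it defines. *)
Definition SL2_invariant (k : closedFieldType) (P : {mpoly k[6 + 4]}) : Prop :=
  forall (g : 'M[k]_2) (v : V53 k),
    \det g = 1 -> value P (V53_act g v) = value P v.

Definition homog_pos (k : closedFieldType) (P : {mpoly k[6 + 4]}) : Prop :=
  exists2 d : nat, (0 < d)%N & P \is d.-homog.

Definition degF (m : 'X_{1..6 + 4}) : nat := (\sum_(i < 6) m (lshift 4 i))%N.
Definition degG (m : 'X_{1..6 + 4}) : nat := (\sum_(j < 4) m (rshift 6 j))%N.

Definition of_bidegree (k : closedFieldType) (d e : nat)
    (P : {mpoly k[6 + 4]}) : Prop :=
  {in msupp P, forall m, degF m = d /\ degG m = e}.

Definition bihomog (k : closedFieldType) (P : {mpoly k[6 + 4]}) : Prop :=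
  exists d e : nat, of_bidegree d e P.

Definition bihomog_pos (k : closedFieldType) (P : {mpoly k[6 + 4]}) : Prop :=
  exists d e : nat, (0 < d + e)%N /\ of_bidegree d e P.

Definition null_cone (k : closedFieldType) (v : V53 k) : Prop :=
  forall P : {mpoly k[6 + 4]}, SL2_invariant P -> homog_pos P -> value P v = 0.

Definition common_zero (k : closedFieldType) (s : nat)
    (Q : 'I_s -> {mpoly k[6 + 4]}) (v : V53 k) : Prop :=
  forall i, value (Q i) v = 0.

(* The ring of invariants is a finite module over its subalgebra
   k[theta_1, ..., theta_n]. *)
Definition finite_over (k : closedFieldType) (n : nat)
    (theta : n.-tuple {mpoly k[6 + 4]}) : Prop :=
  exists (r : nat) (h : 'I_r -> {mpoly k[6 + 4]}),
    (forall j, SL2_invariant (h j)) /\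
    (forall P, SL2_invariant P ->
       exists c : 'I_r -> {mpoly k[n]},
         P = \sum_(j < r) (c j \mPo theta) * h j).

(* 7 is the Krull dimension of the ring of invariants. *)
Definition hsop (k : closedFieldType)
    (theta : 7.-tuple {mpoly k[6 + 4]}) : Prop :=
  (forall i, SL2_invariant (tnth theta i) /\ homog_pos (tnth theta i)) /\
  finite_over theta.

(* Main.v *)
(* A pair (F, G) of monomials of torus weights p > 0 and - q < 0 is multiplied
   by (t ^ p, t ^ - q) under diag(t, 1/t), so a bihomogeneous invariant of
   bidegree (d, e) not vanishing at it satisfies p d = q e. The pairs
   (x^5, y^3), (x^5, xy^2), (x^4y, xy^2), (x^3y^2, y^3) and (x^4y, y^3) lie
   outside the null cone and give five different ratios d / e; the pairs (0, G)
   force d = 0 and the pairs (F, 0) force e = 0. Hence seven of the Q_i are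
   distinct. An eighth comes from a pencil of quintics meeting the null cone
   only at 0: an invariant with e = 0 has a nontrivial zero on it, where another
   Q_i with e = 0 must be nonzero. That the pairs used are not null is
   witnessed by explicit invariants built from transvectants.

   For a system of parameters theta, let v be a common zero and P an invariant
   of degree d > 0. On the line k v, P ^ N is P(v) ^ N t ^ (d N), but it is
   also a k-linear combination of the restrictions of finitely many module
   generators, of bounded degree in t; hence P(v) = 0. *)

Require Import Defs.
From HB Require Import structures.
From mathcomp Require Import all_boot all_order all_algebra.
From mathcomp Require Import ring zify.
From Stdlib Require Import Classical_Prop.

Set Implicit Arguments.
Unset Strict Implicit.
Unset Printing Implicit Defensive.

Import GRing.Theory.
Local Open Scope ring_scope.

(** * Covariants of quadratics, cubics and quintics, and their SL2-equivariance *)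

Section Covariants.

Variable R : comNzRingType.

(** Coefficients are listed from the highest power of x down, without binomial factors. The ring is
    arbitrary so that one formula serves both for scalars and for polynomial coefficients. *)
Definition linear_form : Type := R * R.
Definition quadratic : Type := R * R * R.
Definition cubic : Type := R * R * R * R.
Definition quintic : Type := R * R * R * R * R * R.

Implicit Types (l : linear_form) (p q : quadratic) (h : cubic) (f : quintic).

(** [act1] to [act5] expand the substitution x |-> a x + b y, y |-> c x + d y on coefficients. *)
Definition act1 (a b c d : R) l : linear_form :=
  let: (l0, l1) := l in (l0 * a + l1 * c, l0 * b + l1 * d).

Definition act2 (a b c d : R) q : quadratic :=
  let: (q0, q1, q2) := q in
  (q0 * a ^+ 2 + q1 * (a * c) + q2 * c ^+ 2,
   q0 * (a * b *+ 2) + q1 * (a * d + b * c) + q2 * (c * d *+ 2),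
   q0 * b ^+ 2 + q1 * (b * d) + q2 * d ^+ 2).

Definition act3 (a b c d : R) h : cubic :=
  let: (h0, h1, h2, h3) := h in
  (h0 * a ^+ 3 + h1 * (a ^+ 2 * c) + h2 * (a * c ^+ 2) + h3 * c ^+ 3,
   h0 * (a ^+ 2 * b *+ 3) + h1 * (a ^+ 2 * d + a * b * c *+ 2)
     + h2 * (a * c * d *+ 2 + b * c ^+ 2) + h3 * (c ^+ 2 * d *+ 3),
   h0 * (a * b ^+ 2 *+ 3) + h1 * (a * b * d *+ 2 + b ^+ 2 * c)
     + h2 * (a * d ^+ 2 + b * c * d *+ 2) + h3 * (c * d ^+ 2 *+ 3),
   h0 * b ^+ 3 + h1 * (b ^+ 2 * d) + h2 * (b * d ^+ 2) + h3 * d ^+ 3).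

Definition act5 (a b c d : R) f : quintic :=
  let: (f0, f1, f2, f3, f4, f5) := f in
  (f0 * a ^+ 5 + f1 * (a ^+ 4 * c) + f2 * (a ^+ 3 * c ^+ 2)
     + f3 * (a ^+ 2 * c ^+ 3) + f4 * (a * c ^+ 4) + f5 * c ^+ 5,
   f0 * (a ^+ 4 * b *+ 5) + f1 * (a ^+ 4 * d + a ^+ 3 * b * c *+ 4)
     + f2 * (a ^+ 3 * c * d *+ 2 + a ^+ 2 * b * c ^+ 2 *+ 3)
     + f3 * (a ^+ 2 * c ^+ 2 * d *+ 3 + a * b * c ^+ 3 *+ 2)
     + f4 * (a * c ^+ 3 * d *+ 4 + b * c ^+ 4) + f5 * (c ^+ 4 * d *+ 5),
   f0 * (a ^+ 3 * b ^+ 2 *+ 10)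
     + f1 * (a ^+ 3 * b * d *+ 4 + a ^+ 2 * b ^+ 2 * c *+ 6)
     + f2 * (a ^+ 3 * d ^+ 2 + a ^+ 2 * b * c * d *+ 6
             + a * b ^+ 2 * c ^+ 2 *+ 3)
     + f3 * (a ^+ 2 * c * d ^+ 2 *+ 3 + a * b * c ^+ 2 * d *+ 6
             + b ^+ 2 * c ^+ 3)
     + f4 * (a * c ^+ 2 * d ^+ 2 *+ 6 + b * c ^+ 3 * d *+ 4)
     + f5 * (c ^+ 3 * d ^+ 2 *+ 10),
   f0 * (a ^+ 2 * b ^+ 3 *+ 10)
     + f1 * (a ^+ 2 * b ^+ 2 * d *+ 6 + a * b ^+ 3 * c *+ 4)
     + f2 * (a ^+ 2 * b * d ^+ 2 *+ 3 + a * b ^+ 2 * c * d *+ 6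
             + b ^+ 3 * c ^+ 2)
     + f3 * (a ^+ 2 * d ^+ 3 + a * b * c * d ^+ 2 *+ 6
             + b ^+ 2 * c ^+ 2 * d *+ 3)
     + f4 * (a * c * d ^+ 3 *+ 4 + b * c ^+ 2 * d ^+ 2 *+ 6)
     + f5 * (c ^+ 2 * d ^+ 3 *+ 10),
   f0 * (a * b ^+ 4 *+ 5) + f1 * (a * b ^+ 3 * d *+ 4 + b ^+ 4 * c)
     + f2 * (a * b ^+ 2 * d ^+ 2 *+ 3 + b ^+ 3 * c * d *+ 2)
     + f3 * (a * b * d ^+ 3 *+ 2 + b ^+ 2 * c * d ^+ 2 *+ 3)
     + f4 * (a * d ^+ 4 + b * c * d ^+ 3 *+ 4) + f5 * (c * d ^+ 4 *+ 5),
   f0 * b ^+ 5 + f1 * (b ^+ 4 * d) + f2 * (b ^+ 3 * d ^+ 2)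
     + f3 * (b ^+ 2 * d ^+ 3) + f4 * (b * d ^+ 4) + f5 * d ^+ 5).

Definition cubic_eval h (x y : R) : R :=
  let: (h0, h1, h2, h3) := h in
  h0 * x ^+ 3 + h1 * (x ^+ 2 * y) + h2 * (x * y ^+ 2) + h3 * y ^+ 3.

Definition quintic_eval f (x y : R) : R :=
  let: (f0, f1, f2, f3, f4, f5) := f in
  f0 * x ^+ 5 + f1 * (x ^+ 4 * y) + f2 * (x ^+ 3 * y ^+ 2)
    + f3 * (x ^+ 2 * y ^+ 3) + f4 * (x * y ^+ 4) + f5 * y ^+ 5.

(** The second transvectant up to a factor: the polar form of q |-> 4 q0 q2 - q1^2, which is minus
    the discriminant. *)
Definition quad_pairing p q : R :=
  let: (p0, p1, p2) := p in let: (q0, q1, q2) := q in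
  p0 * q2 *+ 2 - p1 * q1 + p2 * q0 *+ 2.

(* The value of a quadratic form at the zero (l1, - l0) of l0 x + l1 y. *)
Definition quad_at_zero q l : R :=
  let: (q0, q1, q2) := q in let: (l0, l1) := l in
  q0 * l1 ^+ 2 - q1 * (l0 * l1) + q2 * l0 ^+ 2.

(* Up to a constant factor, the transvectants (h, h)_2, (f, f)_4, (q, h)_2,
   (q, f)_2 and (h, f)_3. *)
Definition hessian h : quadratic :=
  let: (h0, h1, h2, h3) := h in
  (h0 * h2 *+ 3 - h1 ^+ 2, h0 * h3 *+ 9 - h1 * h2, h1 * h3 *+ 3 - h2 ^+ 2).

Definition quartic_transvectant f : quadratic :=
  let: (f0, f1, f2, f3, f4, f5) := f in
  (f0 * f4 *+ 20 - f1 * f3 *+ 8 + f2 ^+ 2 *+ 3,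
   f0 * f5 *+ 100 - f1 * f4 *+ 12 + f2 * f3 *+ 2,
   f1 * f5 *+ 20 - f2 * f4 *+ 8 + f3 ^+ 2 *+ 3).

Definition contract_quad_cubic q h : linear_form :=
  let: (q0, q1, q2) := q in let: (h0, h1, h2, h3) := h in
  (q0 * h2 - q1 * h1 + q2 * h0 *+ 3, q0 * h3 *+ 3 - q1 * h2 + q2 * h1).

Definition contract_quad_quintic q f : cubic :=
  let: (q0, q1, q2) := q in let: (f0, f1, f2, f3, f4, f5) := f in
  (q0 * f2 - q1 * f1 *+ 2 + q2 * f0 *+ 10,
   q0 * f3 *+ 3 - q1 * f2 *+ 3 + q2 * f1 *+ 6,
   q0 * f4 *+ 6 - q1 * f3 *+ 3 + q2 * f2 *+ 3,
   q0 * f5 *+ 10 - q1 * f4 *+ 2 + q2 * f3).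

Definition contract_cubic_quintic h f : quadratic :=
  let: (h0, h1, h2, h3) := h in let: (f0, f1, f2, f3, f4, f5) := f in
  (h0 * f3 - h1 * f2 + h2 * f1 *+ 2 - h3 * f0 *+ 10,
   h0 * f4 *+ 4 - h1 * f3 *+ 2 + h2 * f2 *+ 2 - h3 * f1 *+ 4,
   h0 * f5 *+ 10 - h1 * f4 *+ 2 + h2 * f3 - h3 * f2).

Lemma cubic_eval_act a b c d h x y :
  cubic_eval (act3 a b c d h) x y =
  cubic_eval h (a * x + b * y) (c * x + d * y).
Proof. by case: h => [[[h0 h1] h2] h3] /=; ring. Qed.

Lemma quintic_eval_act a b c d f x y :
  quintic_eval (act5 a b c d f) x y =
  quintic_eval f (a * x + b * y) (c * x + d * y).
Proof. by case: f => [[[[[f0 f1] f2] f3] f4] f5] /=; ring. Qed.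

Section Equivariance.

Variables (a b c d : R).
Hypothesis det1 : a * d - b * c = 1.

Lemma quad_pairing_act p q :
  quad_pairing (act2 a b c d p) (act2 a b c d q) = quad_pairing p q.
Proof.
case: p q => [[p0 p1] p2] [[q0 q1] q2] /=.
(* For arbitrary a, b, c, d the two sides differ by the factor (a d - b c)^2. Writing 1 as this
   power leaves a polynomial identity; in the lemmas below the exponent is likewise the weight of
   the covariant. *)
rewrite -[RHS]mul1r -(expr1n _ 2) -det1; ring.
Qed.

Lemma quad_at_zero_act q l :
  quad_at_zero (act2 a b c d q) (act1 a b c d l) = quad_at_zero q l.
Proof.
case: q l => [[q0 q1] q2] [l0 l1] /=.
rewrite -[RHS]mul1r -(expr1n _ 2) -det1; ring.
Qed.

Lemma hessian_act h : hessian (act3 a b c d h) = act2 a b c d (hessian h).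
Proof.
case: h => [[[h0 h1] h2] h3] /=.
by congr (_, _, _); rewrite -[RHS]mul1r -(expr1n _ 2) -det1; ring.
Qed.

Lemma quartic_transvectant_act f :
  quartic_transvectant (act5 a b c d f) =
  act2 a b c d (quartic_transvectant f).
Proof.
case: f => [[[[[f0 f1] f2] f3] f4] f5] /=.
by congr (_, _, _); rewrite -[RHS]mul1r -(expr1n _ 4) -det1; ring.
Qed.

Lemma contract_quad_cubic_act q h :
  contract_quad_cubic (act2 a b c d q) (act3 a b c d h) =
  act1 a b c d (contract_quad_cubic q h).
Proof.
case: q h => [[q0 q1] q2] [[[h0 h1] h2] h3] /=.
by congr (_, _); rewrite -[RHS]mul1r -(expr1n _ 2) -det1; ring.
Qed.

Lemma contract_quad_quintic_act q f :
  contract_quad_quintic (act2 a b c d q) (act5 a b c d f) =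
  act3 a b c d (contract_quad_quintic q f).
Proof.
case: q f => [[q0 q1] q2] [[[[[f0 f1] f2] f3] f4] f5] /=.
by congr (_, _, _, _); rewrite -[RHS]mul1r -(expr1n _ 2) -det1; ring.
Qed.

Lemma contract_cubic_quintic_act h f :
  contract_cubic_quintic (act3 a b c d h) (act5 a b c d f) =
  act2 a b c d (contract_cubic_quintic h f).
Proof.
case: h f => [[[h0 h1] h2] h3] [[[[[f0 f1] f2] f3] f4] f5] /=.
by congr (_, _, _); rewrite -[RHS]mul1r -(expr1n _ 3) -det1; ring.
Qed.

End Equivariance.

End Covariants.

(** * Compatibility of the covariants with ring morphisms *)

Section Morphism.

Variables (R S : comNzRingType) (phi : {rmorphism R -> S}).

Definition map_linear (l : linear_form R) : linear_form S :=
  let: (l0, l1) := l in (phi l0, phi l1).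
Definition map_quad (q : quadratic R) : quadratic S :=
  let: (q0, q1, q2) := q in (phi q0, phi q1, phi q2).
Definition map_cubic (h : cubic R) : cubic S :=
  let: (h0, h1, h2, h3) := h in (phi h0, phi h1, phi h2, phi h3).
Definition map_quintic (f : quintic R) : quintic S :=
  let: (f0, f1, f2, f3, f4, f5) := f in
  (phi f0, phi f1, phi f2, phi f3, phi f4, phi f5).

Let phiE := (rmorphD, rmorphB, rmorphN, rmorphMn, rmorphM, rmorphXn).

Lemma cubic_eval_map h x y :
  phi (cubic_eval h x y) = cubic_eval (map_cubic h) (phi x) (phi y).
Proof. by case: h => [[[h0 h1] h2] h3]; rewrite /= !phiE. Qed.

Lemma quintic_eval_map f x y :
  phi (quintic_eval f x y) = quintic_eval (map_quintic f) (phi x) (phi y).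
Proof. by case: f => [[[[[f0 f1] f2] f3] f4] f5]; rewrite /= !phiE. Qed.

Lemma act3_map a b c d h :
  map_cubic (act3 a b c d h) =
  act3 (phi a) (phi b) (phi c) (phi d) (map_cubic h).
Proof. by case: h => [[[h0 h1] h2] h3]; rewrite /= !phiE. Qed.

Lemma act5_map a b c d f :
  map_quintic (act5 a b c d f) =
  act5 (phi a) (phi b) (phi c) (phi d) (map_quintic f).
Proof. by case: f => [[[[[f0 f1] f2] f3] f4] f5]; rewrite /= !phiE. Qed.

Lemma quad_pairing_map p q :
  phi (quad_pairing p q) = quad_pairing (map_quad p) (map_quad q).
Proof. by case: p q => [[p0 p1] p2] [[q0 q1] q2]; rewrite /= !phiE. Qed.

Lemma quad_at_zero_map q l :
  phi (quad_at_zero q l) = quad_at_zero (map_quad q) (map_linear l).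
Proof. by case: q l => [[q0 q1] q2] [l0 l1]; rewrite /= !phiE. Qed.

Lemma hessian_map h : map_quad (hessian h) = hessian (map_cubic h).
Proof. by case: h => [[[h0 h1] h2] h3]; rewrite /= !phiE. Qed.

Lemma quartic_transvectant_map f :
  map_quad (quartic_transvectant f) = quartic_transvectant (map_quintic f).
Proof. by case: f => [[[[[f0 f1] f2] f3] f4] f5]; rewrite /= !phiE. Qed.

Lemma contract_quad_cubic_map q h :
  map_linear (contract_quad_cubic q h) =
  contract_quad_cubic (map_quad q) (map_cubic h).
Proof.
by case: q h => [[q0 q1] q2] [[[h0 h1] h2] h3]; rewrite /= !phiE.
Qed.

Lemma contract_quad_quintic_map q f :
  map_cubic (contract_quad_quintic q f) =
  contract_quad_quintic (map_quad q) (map_quintic f).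
Proof.
by case: q f => [[q0 q1] q2] [[[[[f0 f1] f2] f3] f4] f5]; rewrite /= !phiE.
Qed.

Lemma contract_cubic_quintic_map h f :
  map_quad (contract_cubic_quintic h f) =
  contract_cubic_quintic (map_cubic h) (map_quintic f).
Proof.
by case: h f => [[[h0 h1] h2] h3] [[[[[f0 f1] f2] f3] f4] f5]; rewrite /= !phiE.
Qed.

End Morphism.

(** * Degrees of the covariants in polynomial coefficients *)

Section Homogeneity.

Variables (n : nat) (R : comNzRingType).
Let P : comNzRingType := {mpoly R[n]}.

Definition linear_homog (d : nat) (l : linear_form P) : bool :=
  let: (l0, l1) := l in (l0 \is d.-homog) && (l1 \is d.-homog).
Definition quad_homog (d : nat) (q : quadratic P) : bool :=
  let: (q0, q1, q2) := q in
  [&& q0 \is d.-homog, q1 \is d.-homog & q2 \is d.-homog].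
Definition cubic_homog (d : nat) (h : cubic P) : bool :=
  let: (h0, h1, h2, h3) := h in
  [&& h0 \is d.-homog, h1 \is d.-homog, h2 \is d.-homog & h3 \is d.-homog].
Definition quintic_homog (d : nat) (f : quintic P) : bool :=
  let: (f0, f1, f2, f3, f4, f5) := f in
  [&& f0 \is d.-homog, f1 \is d.-homog, f2 \is d.-homog, f3 \is d.-homog,
      f4 \is d.-homog & f5 \is d.-homog].

Local Ltac degree_count :=
  rewrite /= ?expr2; repeat (apply/andP; split);
  repeat first [apply: rpredB | apply: rpredD | apply: rpredMn];
  first [exact: dhomogM | by apply: dhomogM => //; apply: dhomogM
        | by rewrite addnC; apply: dhomogM].

Lemma quad_pairing_homog d e p q :
  quad_homog d p -> quad_homog e q -> quad_pairing p q \is (d + e).-homog.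
Proof.
case: p q => [[p0 p1] p2] [[q0 q1] q2] /and3P[? ? ?] /and3P[? ? ?].
degree_count.
Qed.

Lemma quad_at_zero_homog d e q l :
  quad_homog d q -> linear_homog e l ->
  quad_at_zero q l \is (d + (e + e)).-homog.
Proof.
case: q l => [[q0 q1] q2] [l0 l1] /and3P[? ? ?] /andP[? ?]; degree_count.
Qed.

Lemma hessian_homog d h : cubic_homog d h -> quad_homog (d + d) (hessian h).
Proof. case: h => [[[h0 h1] h2] h3] /and4P[? ? ? ?]; degree_count. Qed.

Lemma quartic_transvectant_homog d f :
  quintic_homog d f -> quad_homog (d + d) (quartic_transvectant f).
Proof.
case: f => [[[[[f0 f1] f2] f3] f4] f5] /and5P[? ? ? ? /andP[? ?]]; degree_count.
Qed.

Lemma contract_quad_cubic_homog d e q h :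
  quad_homog d q -> cubic_homog e h ->
  linear_homog (d + e) (contract_quad_cubic q h).
Proof.
case: q h => [[q0 q1] q2] [[[h0 h1] h2] h3] /and3P[? ? ?] /and4P[? ? ? ?].
degree_count.
Qed.

Lemma contract_quad_quintic_homog d e q f :
  quad_homog d q -> quintic_homog e f ->
  cubic_homog (d + e) (contract_quad_quintic q f).
Proof.
case: q f => [[q0 q1] q2] [[[[[f0 f1] f2] f3] f4] f5].
move=> /and3P[? ? ?] /and5P[? ? ? ? /andP[? ?]]; degree_count.
Qed.

Lemma contract_cubic_quintic_homog d e h f :
  cubic_homog d h -> quintic_homog e f ->
  quad_homog (d + e) (contract_cubic_quintic h f).
Proof.
case: h f => [[[h0 h1] h2] h3] [[[[[f0 f1] f2] f3] f4] f5].
move=> /and4P[? ? ? ?] /and5P[? ? ? ? /andP[? ?]]; degree_count.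
Qed.

End Homogeneity.

(** * Binary forms and their coefficients *)

Section Forms.

Variable k : closedFieldType.

Definition form_monom (n j : nat) : {mpoly k[2]} := 'X_0 ^+ (n - j) * 'X_1 ^+ j.

Lemma form_monomE n j :
  form_monom n j =
  'X_[[multinom (if i == ord0 then (n - j)%N else j) | i < 2]].
Proof.
by rewrite mpolyXE_id !big_ord_recl big_ord0 !mnmE mulr1 /form_monom.
Qed.

Lemma mdeg2 (m : 'X_{1..2}) : mdeg m = (m ord0 + m ord_max)%N.
Proof.
rewrite mdegE !big_ord_recl big_ord0 addn0; congr (_ + m _)%N.
exact: val_inj.
Qed.

Lemma formE n (F : binary_form k n) :
  F = \sum_(j < n.+1) form_coef F j *: form_monom n j :> {mpoly k[2]}.
Proof.
apply/mpolyP => m; rewrite raddf_sum /=.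
under eq_bigr => j _ do rewrite mcoeffZ form_monomE mcoeffX.
have hF : (F : {mpoly k[2]}) \is n.-homog := dhomog_is_dhomog F.
have [mn|mn] := eqVneq (mdeg m) n; last first.
  rewrite (dhomog_nemf_coeff hF) // big1 // => j _.
  case: eqP => [em|]; last by rewrite mulr0.
  case/eqP: mn; rewrite -em mdeg2 !mnmE /=.
  by have := ltn_ord j; lia.
(* In degree n a monomial is determined by its exponent of y, so exactly one summand contributes. *)
have [j1 ej1] : exists j1 : 'I_n.+1, j1 = m ord_max :> nat.
  have m1 : (m ord_max < n.+1)%N by rewrite -mn mdeg2 ltnS leq_addl.
  by exists (Ordinal m1).
have em (j : 'I_n.+1) :
  ([multinom (if i == ord0 then (n - j)%N else j : nat) | i < 2] == m)
    = (j == j1).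
  apply/eqP/eqP => [jm|->]; first by apply: val_inj; rewrite /= ej1 -jm mnmE.
  apply/mnmP => i; rewrite mnmE ej1 -mn mdeg2 addnK.
  by case: i => [[|[|//]] i2]; congr (m _); apply: val_inj.
rewrite (bigD1 j1) //= big1 ?addr0 => [|j nj].
  rewrite em eqxx mulr1 /form_coef.
  by congr mcoeff; apply/esym/eqP; rewrite em.
by rewrite em (negbTE nj) mulr0.
Qed.

Lemma form_coef_sum n (F : binary_form k n) (c : 'I_n.+1 -> k) :
  F = \sum_(j < n.+1) c j *: form_monom n j :> {mpoly k[2]} ->
  form_coef F =1 c.
Proof.
move=> FE j; rewrite /form_coef FE raddf_sum /= (bigD1 j) //= big1 => [|i ij].
  by rewrite addr0 mcoeffZ form_monomE mcoeffX eqxx mulr1.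
rewrite mcoeffZ form_monomE mcoeffX; case: eqP => [/mnmP/(_ ord_max)|_].
  by rewrite !mnmE /= => /val_inj eij; rewrite eij eqxx in ij.
by rewrite mulr0.
Qed.

Lemma form_of_coefs_homog n (c : 'I_n.+1 -> k) :
  \sum_(j < n.+1) c j *: form_monom n j \is n.-homog.
Proof.
apply: rpred_sum => j _; apply: rpredZ.
rewrite form_monomE dhomogX /= mdeg2 !mnmE /=.
by apply/eqP; have := ltn_ord j; lia.
Qed.

Definition form_of_coefs n (c : 'I_n.+1 -> k) : binary_form k n :=
  DHomog (form_of_coefs_homog c).

Lemma form_of_coefsK n (c : 'I_n.+1 -> k) : form_coef (form_of_coefs c) =1 c.
Proof. exact: form_coef_sum. Qed.

End Forms.

(** * The action on coefficient tuples, and invariants as polynomial laws *)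

Definition to_quintic (R : comNzRingType) (c : 'I_6 -> R) : quintic R :=
  (c (inord 0), c (inord 1), c (inord 2), c (inord 3), c (inord 4),
   c (inord 5)).
Definition to_cubic (R : comNzRingType) (c : 'I_4 -> R) : cubic R :=
  (c (inord 0), c (inord 1), c (inord 2), c (inord 3)).

Section Actions.

Variable k : closedFieldType.

Definition quintic_fun (f : quintic k) (j : 'I_6) : k :=
  let: (f0, f1, f2, f3, f4, f5) := f in nth 0 [:: f0; f1; f2; f3; f4; f5] j.
Definition cubic_fun (h : cubic k) (j : 'I_4) : k :=
  let: (h0, h1, h2, h3) := h in nth 0 [:: h0; h1; h2; h3] j.

Lemma quintic_funK : cancel quintic_fun (@to_quintic k).
Proof.
by case=> [[[[[f0 f1] f2] f3] f4] f5]; rewrite /to_quintic /= !inordK.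
Qed.

Lemma cubic_funK : cancel cubic_fun (@to_cubic k).
Proof. by case=> [[[h0 h1] h2] h3]; rewrite /to_cubic /= !inordK. Qed.

Lemma eq_to_quintic (c c' : 'I_6 -> k) :
  c =1 c' -> to_quintic c = to_quintic c'.
Proof. by move=> cc'; rewrite /to_quintic !cc'. Qed.

Lemma eq_to_cubic (c c' : 'I_4 -> k) : c =1 c' -> to_cubic c = to_cubic c'.
Proof. by move=> cc'; rewrite /to_cubic !cc'. Qed.

Lemma to_quinticK (c : 'I_6 -> k) : quintic_fun (to_quintic c) =1 c.
Proof.
case=> [[|[|[|[|[|[|//]]]]]] i] /=; congr c; apply: val_inj;
  by rewrite /= inordK.
Qed.

Lemma to_cubicK (c : 'I_4 -> k) : cubic_fun (to_cubic c) =1 c.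
Proof.
by case=> [[|[|[|[|//]]]] i] /=; congr c; apply: val_inj; rewrite /= inordK.
Qed.

Lemma linsubstE (g : 'M[k]_2) i :
  'X_i \mPo linsubst g = (g i 0)%:MP * 'X_0 + (g i 1)%:MP * 'X_1.
Proof.
rewrite comp_mpolyXU -tnth_nth tnth_mktuple !big_ord_recl big_ord0 addr0.
by rewrite !mul_mpolyC; congr (_ + g _ _ *: 'X__); apply: val_inj.
Qed.

Lemma cubic_eval_sum h :
  cubic_eval (map_cubic (@mpolyC 2 k) h) 'X_0 'X_1 =
  \sum_(j < 4) cubic_fun h j *: form_monom k 3 j.
Proof.
case: h => [[[h0 h1] h2] h3]; rewrite !big_ord_recl big_ord0 addr0 /=.
by rewrite -!mul_mpolyC /form_monom /= !mulr1 !mul1r !addrA.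
Qed.

Lemma cubic_formE (G : binary_form k 3) :
  G = cubic_eval (map_cubic (@mpolyC 2 k) (to_cubic (form_coef G))) 'X_0 'X_1
    :> {mpoly k[2]}.
Proof.
rewrite cubic_eval_sum [LHS]formE.
by apply: eq_bigr => j _; rewrite to_cubicK.
Qed.

Lemma cubic_coefP (G : binary_form k 3) h :
  G = cubic_eval (map_cubic (@mpolyC 2 k) h) 'X_0 'X_1 :> {mpoly k[2]} ->
  to_cubic (form_coef G) = h.
Proof.
move=> hE; rewrite -[RHS]cubic_funK; apply: eq_to_cubic; apply: form_coef_sum.
by rewrite -cubic_eval_sum.
Qed.

(** Composition with [linsubst g] is a ring morphism fixing constants, so it passes through
    [cubic_eval] onto the two variables, where [cubic_eval_act] recognizes the expanded action. *)
Lemma cubic_act (g : 'M[k]_2) (G : binary_form k 3) :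
  to_cubic (form_coef (form_act g G)) =
  act3 (g 0 0) (g 0 1) (g 1 0) (g 1 1) (to_cubic (form_coef G)).
Proof.
apply: cubic_coefP; rewrite act3_map cubic_eval_act.
transitivity ((G : {mpoly k[2]}) \mPo linsubst g) => //.
rewrite {1}(cubic_formE G) [LHS]cubic_eval_map -!linsubstE.
suff -> : map_cubic (comp_mpoly (linsubst g)) (map_cubic (@mpolyC 2 k)
            (to_cubic (form_coef G))) =
          map_cubic (@mpolyC 2 k) (to_cubic (form_coef G)) by [].
by case: (to_cubic _) => [[[h0 h1] h2] h3]; rewrite /= !comp_mpolyC.
Qed.

Lemma quintic_eval_sum h :
  quintic_eval (map_quintic (@mpolyC 2 k) h) 'X_0 'X_1 =
  \sum_(j < 6) quintic_fun h j *: form_monom k 5 j.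
Proof.
case: h => [[[[[h0 h1] h2] h3] h4] h5]; rewrite !big_ord_recl big_ord0 addr0 /=.
by rewrite -!mul_mpolyC /form_monom /= !mulr1 !mul1r !addrA.
Qed.

Lemma quintic_formE (F : binary_form k 5) :
  F = quintic_eval (map_quintic (@mpolyC 2 k) (to_quintic (form_coef F)))
        'X_0 'X_1
    :> {mpoly k[2]}.
Proof.
rewrite quintic_eval_sum [LHS]formE.
by apply: eq_bigr => j _; rewrite to_quinticK.
Qed.

Lemma quintic_coefP (F : binary_form k 5) h :
  F = quintic_eval (map_quintic (@mpolyC 2 k) h) 'X_0 'X_1 :> {mpoly k[2]} ->
  to_quintic (form_coef F) = h.
Proof.
move=> hE; rewrite -[RHS]quintic_funK; apply: eq_to_quintic.
apply: form_coef_sum.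
by rewrite -quintic_eval_sum.
Qed.

Lemma quintic_act (g : 'M[k]_2) (F : binary_form k 5) :
  to_quintic (form_coef (form_act g F)) =
  act5 (g 0 0) (g 0 1) (g 1 0) (g 1 1) (to_quintic (form_coef F)).
Proof.
apply: quintic_coefP; rewrite act5_map quintic_eval_act.
transitivity ((F : {mpoly k[2]}) \mPo linsubst g) => //.
rewrite {1}(quintic_formE F) [LHS]quintic_eval_map -!linsubstE.
suff -> : map_quintic (comp_mpoly (linsubst g)) (map_quintic (@mpolyC 2 k)
            (to_quintic (form_coef F))) =
          map_quintic (@mpolyC 2 k) (to_quintic (form_coef F)) by [].
by case: (to_quintic _) => [[[[[h0 h1] h2] h3] h4] h5]; rewrite /= !comp_mpolyC.
Qed.

Definition quintic_of (v : V53 k) : quintic k := to_quintic (form_coef v.1).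
Definition cubic_of (v : V53 k) : cubic k := to_cubic (form_coef v.2).

Definition coord_fun (f : quintic k) (h : cubic k) (i : 'I_(6 + 4)) : k :=
  match split i with inl j => quintic_fun f j | inr j => cubic_fun h j end.

Lemma coordsE v : coords v =1 coord_fun (quintic_of v) (cubic_of v).
Proof.
move=> i; rewrite /coords /coord_fun; case: (split i) => j.
  by rewrite to_quinticK.
by rewrite to_cubicK.
Qed.

Lemma valueE P v : value P v = P.@[coord_fun (quintic_of v) (cubic_of v)].
Proof. exact/meval_eq/coordsE. Qed.

Definition pair_of (f : quintic k) (h : cubic k) : V53 k :=
  (form_of_coefs (quintic_fun f), form_of_coefs (cubic_fun h)).

Lemma quintic_of_pair f h : quintic_of (pair_of f h) = f.
Proof.
by rewrite -[RHS]quintic_funK; apply: eq_to_quintic; apply: form_of_coefsK.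
Qed.

Lemma cubic_of_pair f h : cubic_of (pair_of f h) = h.
Proof.
by rewrite -[RHS]cubic_funK; apply: eq_to_cubic; apply: form_of_coefsK.
Qed.

Definition generic_quintic : quintic {mpoly k[6 + 4]} :=
  to_quintic (fun i => 'X_(lshift 4 i)).
Definition generic_cubic : cubic {mpoly k[6 + 4]} :=
  to_cubic (fun i => 'X_(rshift 6 i)).

Lemma generic_quintic_value v :
  map_quintic (meval (coords v)) generic_quintic = quintic_of v.
Proof.
have cE i : coords v (lshift 4 i) = form_coef v.1 i.
  by rewrite /coords -[lshift 4 i]/(unsplit (inl i)) unsplitK.
by rewrite /quintic_of /to_quintic -!cE /= !mevalXU.
Qed.

Lemma generic_cubic_value v :
  map_cubic (meval (coords v)) generic_cubic = cubic_of v.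
Proof.
have cE i : coords v (rshift 6 i) = form_coef v.2 i.
  by rewrite /coords -[rshift 6 i]/(unsplit (inr i)) unsplitK.
by rewrite /cubic_of /to_cubic -!cE /= !mevalXU.
Qed.

Lemma generic_quintic_homog : quintic_homog 1 generic_quintic.
Proof. by rewrite /= !dhomogX /= !mdeg1 !eqxx. Qed.

Lemma generic_cubic_homog : cubic_homog 1 generic_cubic.
Proof. by rewrite /= !dhomogX /= !mdeg1 !eqxx. Qed.

(* A polynomial law in the pair (f, h), given over all rings at once: [phi k]
   is the invariant function and [phi {mpoly k[6 + 4]}], evaluated at the
   generic pair, the polynomial representing it. *)
Definition invariant_law (d : nat)
    (phi : forall R : comNzRingType, quintic R -> cubic R -> R) : Prop :=
  [/\ forall (a b c d : k) f h, a * d - b * c = 1 ->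
        phi k (act5 a b c d f) (act3 a b c d h) = phi k f h,
      forall (psi : {rmorphism {mpoly k[6 + 4]} -> k}) f h,
        psi (phi _ f h) = phi k (map_quintic psi f) (map_cubic psi h)
    & phi _ generic_quintic generic_cubic \is d.+1.-homog].

Lemma det2 (g : 'M[k]_2) : \det g = g 0 0 * g 1 1 - g 0 1 * g 1 0.
Proof.
rewrite (expand_det_row _ 0) !big_ord_recl big_ord0 addr0.
rewrite /cofactor !det_mx11 !mxE /= expr0 mul1r expr1 mulN1r mulrN.
by congr (_ * g _ _ - g _ _ * g _ _); apply: val_inj.
Qed.

(** At the generic pair the law is an SL2-invariant polynomial, homogeneous of positive degree
    [d.+1], and its value at any pair is the law there. A single nonzero value thus excludes the
    pair from the null cone. *)
Lemma not_null_cone d phi v :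
  invariant_law d phi -> phi k (quintic_of v) (cubic_of v) != 0 ->
  ~ null_cone v.
Proof.
case=> phi_act phi_map phi_homog /eqP nz null_v; apply: nz.
have phiE w : value (phi _ generic_quintic generic_cubic) w =
              phi k (quintic_of w) (cubic_of w).
  by rewrite /value phi_map generic_quintic_value generic_cubic_value.
rewrite -phiE; apply: null_v; last by exists d.+1.
move=> g w; rewrite det2 => det_g.
by rewrite !phiE /quintic_of /cubic_of quintic_act cubic_act phi_act.
Qed.

End Actions.

(** * The explicit invariants *)

Section Invariants.

Variables (k : closedFieldType) (R : comNzRingType).
Implicit Types (f : quintic R) (h : cubic R).

(** In [inv_d_e] the indices are the degrees in the quintic and in the cubic. *)
Definition inv_3_5 f h :=
  let q := contract_cubic_quintic h f in
  quad_at_zero q (contract_quad_cubic q h).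

Definition inv_2_10 f h :=
  let q := hessian h in
  quad_at_zero q (contract_quad_cubic q (contract_quad_quintic q f)).

Definition inv_1_3 f h :=
  quad_pairing (contract_cubic_quintic h f) (hessian h).

Definition inv_3_1 f h :=
  quad_pairing (contract_cubic_quintic h f) (quartic_transvectant f).

Definition inv_2_2 f h :=
  let q := contract_cubic_quintic h f in quad_pairing q q.

Definition inv_0_4 f h := quad_pairing (hessian h) (hessian h).

Definition inv_4_0 f h :=
  let q := quartic_transvectant f in quad_pairing q q.

Definition inv_8_0 f h :=
  let q := quartic_transvectant f in
  quad_pairing q (hessian (contract_quad_quintic q f)).

End Invariants.

Section InvariantLaws.

Variable k : closedFieldType.

Let actE := (quad_pairing_act, quad_at_zero_act, hessian_act,
  quartic_transvectant_act, contract_quad_cubic_act,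
  contract_quad_quintic_act, contract_cubic_quintic_act).
Let mapE := (quad_pairing_map, quad_at_zero_map, hessian_map,
  quartic_transvectant_map, contract_quad_cubic_map,
  contract_quad_quintic_map, contract_cubic_quintic_map).

Let f_homog := generic_quintic_homog k.
Let h_homog := generic_cubic_homog k.
Let q_homog := contract_cubic_quintic_homog h_homog f_homog.
Let t_homog := quartic_transvectant_homog f_homog.
Let hess_homog := hessian_homog h_homog.

Lemma inv_3_5_law : invariant_law k 7 inv_3_5.
Proof.
split=> [a b c d f h det1|psi f h|]; rewrite /inv_3_5 ?actE ?mapE //.
exact: quad_at_zero_homog q_homog (contract_quad_cubic_homog q_homog h_homog).
Qed.

Lemma inv_2_10_law : invariant_law k 11 inv_2_10.
Proof.
split=> [a b c d f h det1|psi f h|]; rewrite /inv_2_10 ?actE ?mapE //.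
have c_homog := contract_quad_quintic_homog hess_homog f_homog.
exact: quad_at_zero_homog hess_homog
         (contract_quad_cubic_homog hess_homog c_homog).
Qed.

Lemma inv_1_3_law : invariant_law k 3 inv_1_3.
Proof.
split=> [a b c d f h det1|psi f h|]; rewrite /inv_1_3 ?actE ?mapE //.
exact: quad_pairing_homog q_homog hess_homog.
Qed.

Lemma inv_3_1_law : invariant_law k 3 inv_3_1.
Proof.
split=> [a b c d f h det1|psi f h|]; rewrite /inv_3_1 ?actE ?mapE //.
exact: quad_pairing_homog q_homog t_homog.
Qed.

Lemma inv_2_2_law : invariant_law k 3 inv_2_2.
Proof.
split=> [a b c d f h det1|psi f h|]; rewrite /inv_2_2 ?actE ?mapE //.
exact: quad_pairing_homog q_homog q_homog.
Qed.

Lemma inv_0_4_law : invariant_law k 3 inv_0_4.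
Proof.
split=> [a b c d f h det1|psi f h|]; rewrite /inv_0_4 ?actE ?mapE //.
exact: quad_pairing_homog hess_homog hess_homog.
Qed.

Lemma inv_4_0_law : invariant_law k 3 inv_4_0.
Proof.
split=> [a b c d f h det1|psi f h|]; rewrite /inv_4_0 ?actE ?mapE //.
exact: quad_pairing_homog t_homog t_homog.
Qed.

Lemma inv_8_0_law : invariant_law k 7 inv_8_0.
Proof.
split=> [a b c d f h det1|psi f h|]; rewrite /inv_8_0 ?actE ?mapE //.
have c_homog := contract_quad_quintic_homog t_homog f_homog.
exact: quad_pairing_homog t_homog (hessian_homog c_homog).
Qed.

End InvariantLaws.

(** * Scaling, restriction to lines and planes, and torus weights *)

Section Evaluation.

Variable k : closedFieldType.

(** Common source of the scaling laws for degree and for bidegree: each monomial of the support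
    picks up the same factor [C]. *)
Lemma meval_scale n (P : {mpoly k[n]}) (c w : 'I_n -> k) (C : k) :
  {in msupp P, forall m : 'X_{1..n}, \prod_i c i ^+ m i = C} ->
  P.@[fun i => c i * w i] = C * P.@[w].
Proof.
move=> cC; rewrite !mevalE mulr_sumr; apply: eq_big_seq => m mP.
rewrite mulrCA -(cC m mP) -big_split /=; congr (_ * _).
by apply: eq_bigr => i _; rewrite exprMn.
Qed.

Lemma meval_homog n d (P : {mpoly k[n]}) (t : k) (w : 'I_n -> k) :
  P \is d.-homog -> P.@[fun i => t * w i] = t ^+ d * P.@[w].
Proof.
move=> /dhomogP Pd; apply: (@meval_scale _ _ (fun=> t)) => m /Pd <-.
by rewrite -expr_sum -mdegE.
Qed.

Lemma meval_line n (P : {mpoly k[n]}) (u w : 'I_n -> k) :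
  exists q : {poly k}, forall t, q.[t] = P.@[fun i => u i + t * w i].
Proof.
exists (\sum_(m <- msupp P) P@_m *: \prod_i ((u i)%:P + w i *: 'X) ^+ m i).
move=> t; rewrite mevalE horner_sum; apply: eq_bigr => m _.
rewrite hornerZ horner_prod; congr (_ * _); apply: eq_bigr => i _.
by rewrite horner_exp !hornerE [w i * t]mulrC.
Qed.

(** If p vanishes everywhere then p + 1 has no root, hence is constant over an algebraically closed
    field. *)
Lemma poly_vanishing (p : {poly k}) : (forall x, p.[x] = 0) -> p = 0.
Proof.
move=> p0; have /size_poly1P[c _ pc] : size (p + 1) == 1%N.
  apply/negPn/negP => /closed_rootP[x].
  by rewrite rootE hornerD p0 add0r hornerC oner_eq0.
have pE : p = (c - 1)%:P by rewrite polyCB -pc addrK.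
by move: (p0 0); rewrite pE hornerC => ->.
Qed.

(** On the plane spanned by u and w, P is a binary form of degree d in a and b. Either it has a zero
    with a = 1, or P(u + t w) is a nonzero constant c in t; then the form is c a^d, which vanishes
    at (0, 1). *)
Lemma homog_zero_on_plane n d (P : {mpoly k[n]}) (u w : 'I_n -> k) :
  (0 < d)%N -> P \is d.-homog ->
  exists a b, (a != 0) || (b != 0) /\ P.@[fun i => a * u i + b * w i] = 0.
Proof.
move=> d_gt0 Pd; have [q qE] := meval_line P u w.
have [/closed_rootP[t /eqP qt]|/negPn/size_poly1P[c _ qc]] :=
  boolP (size q != 1%N).
  exists 1, t; rewrite oner_neq0; split=> //.
  by rewrite -qt qE; apply: meval_eq => i; rewrite mul1r.
have [r rE] := meval_line P w u.
(* Homogeneity gives r(s) = s^d q(1/s) = c s^d only for nonzero s; the factor ['X] takes care of s =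
   0. *)
have r0 : 'X * (r - c *: 'X^d) = 0.
  apply: poly_vanishing => s; rewrite hornerM hornerX.
  have [->|s0] := eqVneq s 0; first by rewrite mul0r.
  rewrite !hornerE rE.
  have -> : P.@[fun i => w i + s * u i] = s ^+ d * q.[s^-1].
    rewrite qE -(meval_homog _ _ Pd); apply: meval_eq => i.
    by rewrite mulrDr mulVKf // addrC.
  by rewrite qc hornerC [c * _]mulrC subrr mulr0.
exists 0, 1; rewrite oner_neq0 orbT; split=> //.
have -> : P.@[fun i => 0 * u i + 1 * w i] = r.[0].
  by rewrite rE; apply: meval_eq => i; rewrite !mul0r mul1r addrC.
move/eqP: r0; rewrite mulf_eq0 polyX_eq0 /= subr_eq0 => /eqP ->.
by rewrite hornerZ hornerXn expr0n -[d]prednK //= mulr0.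
Qed.

Definition scale_quintic (t : k) (f : quintic k) : quintic k :=
  let: (f0, f1, f2, f3, f4, f5) := f in
  (t * f0, t * f1, t * f2, t * f3, t * f4, t * f5).
Definition scale_cubic (t : k) (h : cubic k) : cubic k :=
  let: (h0, h1, h2, h3) := h in (t * h0, t * h1, t * h2, t * h3).

Lemma value_scale d e (Q : {mpoly k[6 + 4]}) t u f h :
  of_bidegree d e Q ->
  value Q (pair_of (scale_quintic t f) (scale_cubic u h)) =
  t ^+ d * u ^+ e * value Q (pair_of f h).
Proof.
move=> Qde; rewrite !valueE !quintic_of_pair !cubic_of_pair.
pose c (i : 'I_(6 + 4)) := match split i with inl _ => t | inr _ => u end.
rewrite -(@meval_scale _ _ c) => [|m /Qde[<- <-]].
  apply: meval_eq => i; rewrite /coord_fun /c; case: (split i) => j.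
    case: f => [[[[[f0 f1] f2] f3] f4] f5].
    by case: j => [[|[|[|[|[|[|//]]]]]] ?].
  case: h => [[[h0 h1] h2] h3].
  by case: j => [[|[|[|[|//]]]] ?].
rewrite big_split_ord /= /degF /degG !expr_sum.
congr (_ * _); apply: eq_bigr => i _; rewrite /c.
  by rewrite -[lshift 4 i]/(unsplit (inl i)) unsplitK.
by rewrite -[rshift 6 i]/(unsplit (inr i)) unsplitK.
Qed.

(** Scaling the zero quintic by 0 does not change the pair, so the value equals 0^d times itself. *)
Lemma value_bidegree0l d e (Q : {mpoly k[6 + 4]}) h :
  of_bidegree d e Q ->
  value Q (pair_of (0, 0, 0, 0, 0, 0) h) != 0 -> d = 0%N.
Proof.
move=> Qde; have := value_scale 0 1 (0, 0, 0, 0, 0, 0) h Qde.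
have -> : scale_cubic 1 h = h.
  by case: h => [[[h0 h1] h2] h3] /=; rewrite !mul1r.
rewrite /= !mul0r expr0n; case: d Qde => // d _ ->.
by rewrite !mul0r eqxx.
Qed.

Lemma value_bidegree0r d e (Q : {mpoly k[6 + 4]}) f :
  of_bidegree d e Q -> value Q (pair_of f (0, 0, 0, 0)) != 0 -> e = 0%N.
Proof.
move=> Qde; have := value_scale 1 0 f (0, 0, 0, 0) Qde.
have -> : scale_quintic 1 f = f.
  by case: f => [[[[[f0 f1] f2] f3] f4] f5] /=; rewrite !mul1r.
rewrite /= !mul0r expr0n; case: e Qde => // e _ ->.
by rewrite mulr0 mul0r eqxx.
Qed.

Lemma natr_inj_pchar0 : [pchar k] =i pred0 -> injective (fun n => n%:R : k).
Proof.
move=> /pcharf0P nz m n; wlog le_mn : m n / (m <= n)%N => [wl mn|/eqP].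
  by case/orP: (leq_total m n) => /wl; [apply|move=> /(_ (esym mn))].
rewrite eq_sym -subr_eq0 -natrB // nz subn_eq0 => le_nm.
by apply/eqP; rewrite eqn_leq le_mn.
Qed.

Lemma value_act (Q : {mpoly k[6 + 4]}) (g : 'M[k]_2) f h :
  value Q (V53_act g (pair_of f h)) =
  value Q (pair_of (act5 (g 0 0) (g 0 1) (g 1 0) (g 1 1) f)
                   (act3 (g 0 0) (g 0 1) (g 1 0) (g 1 1) h)).
Proof.
rewrite !valueE quintic_of_pair cubic_of_pair.
by rewrite /quintic_of /cubic_of quintic_act cubic_act -/(quintic_of _)
  -/(cubic_of _) quintic_of_pair cubic_of_pair.
Qed.

(* The torus element diag(2, 1/2) multiplies f by 2 ^ (i - j) and h by
   2 ^ (i' - j'). *)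
Lemma torus_weights d e (Q : {mpoly k[6 + 4]}) f h i j i' j' :
  [pchar k] =i pred0 -> SL2_invariant Q -> of_bidegree d e Q ->
  (forall t u, act5 t 0 0 u f = scale_quintic (t ^+ i * u ^+ j) f) ->
  (forall t u, act3 t 0 0 u h = scale_cubic (t ^+ i' * u ^+ j') h) ->
  value Q (pair_of f h) != 0 -> (i * d + i' * e = j * d + j' * e)%N.
Proof.
move=> char0 Qinv Qde fE hE nz; have /pcharf0P nat0 := char0.
have two0 : 2%:R != 0 :> k by rewrite nat0.
pose g : 'M[k]_2 :=
  \matrix_(r, c) (if r == c then if r == 0 then 2%:R else 2%:R^-1 else 0).
have det_g : \det g = 1 by rewrite det2 !mxE /= mul0r subr0 divff.
have := Qinv g (pair_of f h) det_g; rewrite value_act !mxE /= fE hE.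
rewrite (value_scale _ _ _ _ Qde) -[RHS]mul1r => /(mulIf nz).
have pow0 : 2%:R ^+ (j * d + j' * e) != 0 :> k by rewrite expf_neq0.
rewrite !exprMn -!exprM mulrACA -!exprD exprVn => /(canRL (mulfVK pow0)).
(* In characteristic zero an equality between powers of 2 in k already holds in the natural numbers,
   where the exponents can be compared. *)
rewrite mul1r -!natrX.
by move/(natr_inj_pchar0 char0)/eqP; rewrite eqn_exp2l // => /eqP.
Qed.

End Evaluation.

Lemma mdeg_bidegree (m : 'X_{1..6 + 4}) : mdeg m = (degF m + degG m)%N.
Proof. by rewrite mdegE big_split_ord. Qed.

Lemma bidegree_homog (k : closedFieldType) d e (P : {mpoly k[6 + 4]}) :
  of_bidegree d e P -> P \is (d + e).-homog.
Proof. by move=> Pde; apply/dhomogP => m /Pde[<- <-]; exact: mdeg_bidegree. Qed.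

Lemma bihomog_homog_pos (k : closedFieldType) n (P : {mpoly k[6 + 4]}) :
  bihomog P -> (0 < n)%N -> P \is n.-homog -> bihomog_pos P.
Proof.
move=> [d [e Pde]] n_gt0 Pn; have [->|nz] := eqVneq P 0.
  (* The zero polynomial has every bidegree, so a positive one can be chosen. *)
  by exists 1%N, 0%N; split=> // m; rewrite msupp0.
exists d, e; split=> //.
by rewrite -(dhomog_uniq nz Pn (bidegree_homog Pde)).
Qed.

(** * Pairs outside the null cone *)

Section NonNullPairs.

Variable k : closedFieldType.
Hypothesis char0 : [pchar k] =i pred0.

Let nat0 : forall n, (n%:R == 0 :> k) = (n == 0)%N.
Proof. exact/pcharf0P. Qed.

Lemma pair_not_null d phi (f : quintic k) (h : cubic k) :
  invariant_law k d phi -> phi k f h != 0 -> ~ null_cone (pair_of f h).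
Proof.
move=> law nz; apply: not_null_cone law _.
by rewrite quintic_of_pair cubic_of_pair.
Qed.

(* The forms a (5 x^4 y - y^5) + b (x^5 + 5 x y^4): inv_4_0 is proportional to
   (a b)^2 on this pencil. *)
Definition pencil (a b : k) : quintic k := (b, a *+ 5, 0, 0, b *+ 5, - a).

(** [inv_4_0] detects the members with a b nonzero; on the two remaining lines it vanishes and
    [inv_8_0] takes over. *)
Lemma pencil_not_null a b :
  (a != 0) || (b != 0) -> ~ null_cone (pair_of (pencil a b) (0, 0, 0, 0)).
Proof.
have [-> /= b0|a0 _] := eqVneq a 0.
  apply: pair_not_null (inv_8_0_law k) _.
  (* Here [quartic_transvectant] gives 100 b^2 x^2, and contracting it with the quintic gives 6 * 5
     * 100 b^3 x y^2. *)
  have -> : inv_8_0 (pencil 0 b) (0, 0, 0, 0) =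
            - ((2 * 100)%:R * (6 * 5 * 100)%:R ^+ 2 * b ^+ 8).
    by rewrite /inv_8_0 /=; ring.
  by rewrite oppr_eq0 !mulf_neq0 ?expf_neq0 ?nat0.
have [->|b0] := eqVneq b 0.
  apply: pair_not_null (inv_8_0_law k) _.
  have -> : inv_8_0 (pencil a 0) (0, 0, 0, 0) =
            (2 * 100)%:R * (6 * 5 * 100)%:R ^+ 2 * a ^+ 8.
    by rewrite /inv_8_0 /=; ring.
  by rewrite !mulf_neq0 ?expf_neq0 ?nat0.
apply: pair_not_null (inv_4_0_law k) _.
have -> : inv_4_0 (pencil a b) (0, 0, 0, 0) =
          - (20%:R * 100%:R ^+ 2 * (a * b) ^+ 2).
  by rewrite /inv_4_0 /=; ring.
by rewrite oppr_eq0 !mulf_neq0 ?expf_neq0 ?mulf_neq0 ?nat0.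
Qed.

(** For this and the next four pairs, the invariant is chosen with the ratio of degrees that the
    torus weights force on any bihomogeneous invariant nonzero there. Here the contraction of cubic
    and quintic is -10 x^2 and the linear covariant is -30 y. *)
Lemma not_null_x5_y3 :
  ~ null_cone (pair_of (1, 0, 0, 0, 0, 0) (0, 0, 0, 1 : k)).
Proof.
apply: pair_not_null (inv_3_5_law k) _.
rewrite [inv_3_5 _ _](_ : _ = - (10 * (10 * 3) ^ 2)%:R).
  by rewrite oppr_eq0 nat0.
by rewrite /inv_3_5 /=; ring.
Qed.

Lemma not_null_x5_xy2 :
  ~ null_cone (pair_of (1, 0, 0, 0, 0, 0) (0, 0, 1 : k, 0)).
Proof.
apply: pair_not_null (inv_2_10_law k) _.
rewrite [inv_2_10 _ _](_ : _ = - 900%:R).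
  by rewrite oppr_eq0 nat0.
by rewrite /inv_2_10 /=; ring.
Qed.

Lemma not_null_x4y_xy2 :
  ~ null_cone (pair_of (0, 1, 0, 0, 0, 0) (0, 0, 1 : k, 0)).
Proof.
apply: pair_not_null (inv_1_3_law k) _.
rewrite [inv_1_3 _ _](_ : _ = - 4%:R); first by rewrite oppr_eq0 nat0.
by rewrite /inv_1_3 /=; ring.
Qed.

Lemma not_null_x3y2_y3 :
  ~ null_cone (pair_of (0, 0, 1, 0, 0, 0) (0, 0, 0, 1 : k)).
Proof.
apply: pair_not_null (inv_3_1_law k) _.
rewrite [inv_3_1 _ _](_ : _ = - 6%:R); first by rewrite oppr_eq0 nat0.
by rewrite /inv_3_1 /=; ring.
Qed.

Lemma not_null_x4y_y3 :
  ~ null_cone (pair_of (0, 1, 0, 0, 0, 0) (0, 0, 0, 1 : k)).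
Proof.
apply: pair_not_null (inv_2_2_law k) _.
rewrite [inv_2_2 _ _](_ : _ = - 16%:R); first by rewrite oppr_eq0 nat0.
by rewrite /inv_2_2 /=; ring.
Qed.

(** Every cubic monomial has a multiple root and is null when paired with 0, so a cubic with
    distinct roots is used; [inv_0_4] is a multiple of the discriminant. *)
Lemma not_null_0_x3y3 :
  ~ null_cone (pair_of (0, 0, 0, 0, 0, 0) (1, 0, 0, 1 : k)).
Proof.
apply: pair_not_null (inv_0_4_law k) _.
rewrite [inv_0_4 _ _](_ : _ = - 81%:R); first by rewrite oppr_eq0 nat0.
by rewrite /inv_0_4 /=; ring.
Qed.

End NonNullPairs.

(** * The lower bound for bihomogeneous invariants *)

Section Bound.

Variables (k : closedFieldType) (s : nat) (Q : 'I_s -> {mpoly k[6 + 4]}).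
Hypothesis char0 : [pchar k] =i pred0.
Hypothesis Q_inv : forall i, SL2_invariant (Q i) /\ bihomog_pos (Q i).
Hypothesis Q_null : forall v, common_zero Q v -> null_cone v.

Lemma nonzero_at v : ~ null_cone v -> exists i, value (Q i) v != 0.
Proof.
move=> nn; have [i|Q0] := pickP (fun i => value (Q i) v != 0).
  by exists i.
by case: nn; apply: Q_null => i; apply/eqP/negPn; rewrite Q0.
Qed.

Lemma bihomog_invariants_ge8 : (8 <= s)%N.
Proof.
have /fin_all_exists[d /fin_all_exists[e Qde]] i := (Q_inv i).2.
have pos i : (0 < d i + e i)%N := (Qde i).1.
have bideg i : of_bidegree (d i) (e i) (Q i) := (Qde i).2.
have weights m m' p p' i f h := @torus_weights k _ _ _ f h m m' p p'
  char0 (Q_inv i).1 (bideg i).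
have [i1 nz1] := nonzero_at (not_null_x5_y3 char0).
(* Exponents of x stand on the left, those of y on the right. The five relations reduce to 5 d = 3
   e, 5 d = e, 3 d = e, d = 3 e and d = e. *)
have w1 : (5 * d i1 + 0 * e i1 = 0 * d i1 + 3 * e i1)%N.
  apply: weights nz1 => t u /=; [congr (_, _, _, _, _, _)|congr (_, _, _, _)];
    ring.
have [i2 nz2] := nonzero_at (not_null_x5_xy2 char0).
have w2 : (5 * d i2 + 1 * e i2 = 0 * d i2 + 2 * e i2)%N.
  apply: weights nz2 => t u /=; [congr (_, _, _, _, _, _)|congr (_, _, _, _)];
    ring.
have [i3 nz3] := nonzero_at (not_null_x4y_xy2 char0).
have w3 : (4 * d i3 + 1 * e i3 = 1 * d i3 + 2 * e i3)%N.
  apply: weights nz3 => t u /=; [congr (_, _, _, _, _, _)|congr (_, _, _, _)];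
    ring.
have [i4 nz4] := nonzero_at (not_null_x3y2_y3 char0).
have w4 : (3 * d i4 + 0 * e i4 = 2 * d i4 + 3 * e i4)%N.
  apply: weights nz4 => t u /=; [congr (_, _, _, _, _, _)|congr (_, _, _, _)];
    ring.
have [i5 nz5] := nonzero_at (not_null_x4y_y3 char0).
have w5 : (4 * d i5 + 0 * e i5 = 1 * d i5 + 3 * e i5)%N.
  apply: weights nz5 => t u /=; [congr (_, _, _, _, _, _)|congr (_, _, _, _)];
    ring.
have [i6 nz6] := nonzero_at (not_null_0_x3y3 char0).
have d6 : d i6 = 0%N := value_bidegree0l (bideg i6) nz6.
have [i7 nz7] : exists i, value (Q i) (pair_of (pencil 1 1) (0, 0, 0, 0)) != 0.
  by apply/nonzero_at/pencil_not_null; rewrite // oner_neq0.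
have e7 : e i7 = 0%N := value_bidegree0r (bideg i7) nz7.
(* The index [i8] would satisfy the same degree condition as [i7], so the two are separated by
   values: [i8] is taken at a nonzero member of the pencil where [Q i7] vanishes. *)
have [a [b [ab Qab]]] : exists a b, (a != 0) || (b != 0) /\
    value (Q i7) (pair_of (pencil a b) (0, 0, 0, 0)) = 0.
  have [a [b [ab Qab]]] := homog_zero_on_plane
    (coord_fun (pencil 1 0) (0, 0, 0, 0)) (coord_fun (pencil 0 1) (0, 0, 0, 0))
    (pos i7) (bidegree_homog (bideg i7)).
  exists a, b; split=> //; rewrite -[RHS]Qab valueE.
  rewrite quintic_of_pair cubic_of_pair; apply: meval_eq => i.
  rewrite /coord_fun; case: (split i) => j.
    by case: j => [[|[|[|[|[|[|//]]]]]] ?] /=; ring.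
  by case: j => [[|[|[|[|//]]]] ?] /=; ring.
have [i8 nz8] := nonzero_at (pencil_not_null char0 ab).
have e8 : e i8 = 0%N := value_bidegree0r (bideg i8) nz8.
have i78 : i7 != i8 by apply: contraNneq nz8 => <-; rewrite Qab.
(* Apart from i7 = i8, any coincidence imposes two independent linear conditions on (d, e), forcing
   d = e = 0 against positivity. *)
have uniq_is : uniq [:: i1; i2; i3; i4; i5; i6; i7; i8].
  move: (pos i1) (pos i2) (pos i3) (pos i4) (pos i5) (pos i6) (pos i7) (pos i8).
  rewrite /= !inE !negb_or i78 => *.
  clear nz1 nz2 nz3 nz4 nz5 nz6 nz7 nz8 i78.
  by repeat (apply/andP; split) => //; apply/eqP => ij; subst; lia.
move/card_uniqP: uniq_is => /= <-.
by rewrite -[X in (_ <= X)%N]card_ord max_card.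
Qed.

End Bound.

(** * Systems of parameters and the null cone *)

Lemma finite_over_null_cone (k : closedFieldType) n
    (theta : n.-tuple {mpoly k[6 + 4]}) v :
  (forall i, homog_pos (tnth theta i)) -> finite_over theta ->
  (forall i, value (tnth theta i) v = 0) -> null_cone v.
Proof.
move=> theta_homog [r [h [_ gen]]] theta0 P Pinv [d d_gt0 Pd].
apply/eqP/negPn/negP => nz.
have [q qE] : exists q : 'I_r -> {poly k}, forall j t,
    (q j).[t] = (h j).@[fun i => t * coords v i].
  apply: (@fin_all_exists _ (fun=> {poly k}) (fun j q => forall t,
    q.[t] = (h j).@[fun i => t * coords v i])) => j.
  have [q qE] := meval_line (h j) (fun=> 0) (coords v).
  by exists q => t; rewrite qE; apply: meval_eq => i; rewrite add0r.
(* All [q j] have size at most N, whereas a nonzero multiple of X^(d N) has size d N + 1 > N. *)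
pose N := (\max_(j < r) size (q j))%N.
have PN_inv : SL2_invariant (P ^+ N).
  by move=> g w det_g; rewrite /value !rmorphXn /= -!/(value _ _) Pinv.
have [c PNE] := gen _ PN_inv.
(* By homogeneity the [theta] vanish on the whole line through v, so each coefficient [c j]
   contributes only its value at the origin. *)
have PN_line : (value P v ^+ N) *: 'X^(d * N) =
               \sum_(j < r) (c j).@[fun=> 0] *: q j.
  apply/eqP; rewrite -subr_eq0; apply/eqP; apply: poly_vanishing => t.
  apply/eqP; rewrite hornerD hornerN subr_eq0 hornerZ hornerXn; apply/eqP.
  have -> : value P v ^+ N * t ^+ (d * N) = (P ^+ N).@[fun i => t * coords v i].
    by rewrite rmorphXn /= (meval_homog _ _ Pd) exprMn -exprM mulrC.
  rewrite PNE raddf_sum horner_sum; apply: eq_bigr => j _ /=.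
  rewrite mevalM comp_mpoly_meval hornerZ qE; congr (_ * _).
  apply: meval_eq => i; have [di di_gt0 hi] := theta_homog i.
  by rewrite (meval_homog _ _ hi) -/(value _ _) theta0 mulr0.
have : (size ((value P v ^+ N) *: 'X^(d * N) : {poly k}) <= N)%N.
  rewrite PN_line (leq_trans (size_sum _ _ _)) //; apply/bigmax_leqP => j _.
  exact: leq_trans (size_scale_leq _ _) (leq_bigmax _).
rewrite size_scale ?expf_neq0 // size_polyXn ltnNge.
by rewrite leq_pmull.
Qed.

Theorem theorem4p5 (k : closedFieldType) (char0 : [pchar k] =i pred0) :
  (forall (s : nat) (Q : 'I_s -> {mpoly k[6 + 4]}),
     (forall i, SL2_invariant (Q i) /\ bihomog_pos (Q i)) ->
     (forall v : V53 k, common_zero Q v <-> null_cone v) ->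
     (8 <= s)%N) /\
  (forall theta : 7.-tuple {mpoly k[6 + 4]},
     hsop theta -> exists i, ~ bihomog (tnth theta i)).
Proof.
split=> [s Q Q_inv Q_null|theta [theta_inv theta_fin]].
  by apply: (bihomog_invariants_ge8 char0 Q_inv) => v /Q_null.
apply: NNPP => all_bihomog.
have bihomog_theta i : bihomog (tnth theta i).
  by apply: NNPP => not_bihomog; apply: all_bihomog; exists i.
(* Were all members bihomogeneous, seven bihomogeneous invariants would have their common zeros
   inside the null cone. *)
suff : (8 <= 7)%N by [].
apply: (@bihomog_invariants_ge8 k 7 (tnth theta) char0) => [i|v].
  have [inv_i [m m_gt0 m_homog]] := theta_inv i; split=> //.
  exact: bihomog_homog_pos (bihomog_theta i) m_gt0 m_homog.
by apply: finite_over_null_cone theta_fin => i; case: (theta_inv i).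
Qed.
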